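(* Let $n\ge 2$ and $N\ge 1$ be integers. There is a constant $C=C(n,N)<\infty$, depending only on $n$ and $N$, such that the following holds. Let $\mathcal V$ be a linear subspace of the space $\mathcal X(\mathbb R^n)$ of smooth vector fields on $\mathbb R^n$. Assume that for each $X\in\mathcal V$ the flow $(t,x)\mapsto e^{tX}(x)$ is a polynomial of degree at most $N$ in $(t,x)\in\mathbb R\times\mathbb R^n$, and that $\mathcal V$ obeys the Hörmander condition of order $N$ on $\mathbb R^n$. Let $\mathcal L$ be a finite collection of integral curves $\{e^{tX}(x_0):t\in\mathbb R\}$ of vector fields $X\in\mathcal V$, and let $\mathcal J$ be the set of joints formed by elements of $\mathcal L$. Then $$\#\mathcal J\le C\,(\#\mathcal L)^{\frac{n}{n-1}}.$$
   Context: For a vector field $X$, $e^{tX}(x)$ denotes the time-$t$ flow of $X$ started at $x$. Integral curves are regarded as subsets of $\mathbb R^n$ (a single point is allowed when $X$ vanishes there). Hörmander condition: a collection $\mathcal A$ of smooth vector fields on $\mathbb R^n$ obeys the Hörmander condition of order $N$ on $\mathbb R^n$ if the iterated Lie brackets $[X_1,[X_2,[\cdots,[X_{m-1},X_m]\cdots]]]$ with $m\le N$ and $X_j\in\mathcal A$ (for $m=1$ this is just $X_1$) span the tangent space to $\mathbb R^n$ at every point. Joint: a point $p\in\mathbb R^n$ is a joint (formed by elements of $\mathcal L$) if there exist finitely many $X_1,\dots,X_k\in\mathcal V$, whose linear span is $\mathcal V$, such that $\{e^{tX_j}(p):t\in\mathbb R\}\in\mathcal L$ for every $1\le j\le k$.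 *)

(* Defs.v *)
From HB Require Import structures.
From mathcomp Require Import all_boot all_order all_algebra.
From mathcomp Require mpoly.

Set Implicit Arguments.
Unset Strict Implicit.
Unset Printing Implicit Defensive.

(* The notations of mpoly clash with those of all_analysis, hence the import
   local to a module that precedes it. [msize] is the total degree plus one, and
   0 for the zero polynomial. *)
Module PolyFun.
Import GRing.Theory mpoly.
Local Open Scope ring_scope.

Definition poly_fun (R : comNzRingType) (n N : nat) (f : ('I_n -> R) -> R)
    : Prop :=
  exists P : {mpoly R[n]},
    (msize P <= N.+1)%N /\ forall v : 'I_n -> R, f v = P.@[v].

End PolyFun.

From mathcomp Require Import finmap.
From mathcomp Require Import all_classical all_reals all_analysis.
Import PolyFun.
Import Order.TTheory GRing.Theory Num.Theory.
Import numFieldNormedType.Exports.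

Local Open Scope classical_set_scope.
Local Open Scope ring_scope.

Notation "''VF[' R ]_ n" := ('rV[R]_n -> 'rV[R]_n)
  (at level 8, n at level 2, format "''VF[' R ]_ n") : type_scope.

Definition lspan (R : realType) (W : lmodType R) (A : set W) : set W :=
  [set w | exists (k : nat) (c : 'I_k -> R) (u : 'I_k -> W),
     (forall i, A (u i)) /\ w = \sum_(i < k) c i *: u i].

(* The partial derivative along the last index of [s] is taken first. *)
Definition partials (R : realType) (n : nat) (s : seq 'I_n) (X : 'VF[R]_n)
    : 'VF[R]_n :=
  foldr (fun (i : 'I_n) (Y : 'VF[R]_n) =>
           (fun x => 'D_(delta_mx 0 i) Y x) : 'VF[R]_n) X s.

Definition smooth (R : realType) (n : nat) (X : 'VF[R]_n) : Prop :=
  forall s : seq 'I_n,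
    continuous (partials s X) /\
    forall (i : 'I_n) (x : 'rV[R]_n), derivable (partials s X) x (delta_mx 0 i).

Definition smooth_subspace (R : realType) (n : nat) (V : set 'VF[R]_n) : Prop :=
  [/\ V `<=` @smooth R n, V 0 &
      forall (a : R) (X Y : 'VF[R]_n), V X -> V Y -> V (a *: X + Y)].

Definition lie_bracket (R : realType) (n : nat) (X Y : 'VF[R]_n) : 'VF[R]_n :=
  fun x => 'd Y x (X x) - 'd X x (Y x).

(* [nested_brackets A m] involves m.+1 elements of A. *)
Fixpoint nested_brackets (R : realType) (n : nat) (A : set 'VF[R]_n) (m : nat)
    : set 'VF[R]_n :=
  if m is m'.+1
  then [set lie_bracket X Y | X in A & Y in nested_brackets A m']
  else A.

Definition hormander (R : realType) (n N : nat) (A : set 'VF[R]_n) : Prop :=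
  forall p : 'rV[R]_n,
    lspan [set B p | B in \bigcup_(m in `I_N) nested_brackets A m] = setT.

Definition is_flow (R : realType) (n : nat) (X : 'VF[R]_n)
    (Phi : R -> 'VF[R]_n) : Prop :=
  forall x : 'rV[R]_n,
    Phi 0 x = x /\
    forall t : R, is_derive t 1 (fun s : R => Phi s x) (X (Phi t x)).

(* [flow X t x] is e^{tX}(x). A global flow of a smooth field is unique; the
   default value is only reached when X is not complete. *)
Definition flow (R : realType) (n : nat) (X : 'VF[R]_n) : R -> 'VF[R]_n :=
  xget (fun (_ : R) (x : 'rV[R]_n) => x) (is_flow X).

(* The flow is global, and each of its coordinates is a polynomial of total
   degree at most N in the n.+1 variables (t, x): variable ord0 is t, and
   variable lift ord0 i is the i-th coordinate of x. *)
Definition polynomial_flow (R : realType) (n N : nat) (X : 'VF[R]_n) : Prop :=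
  is_flow X (flow X) /\
  forall j : 'I_n,
    poly_fun N (fun v : 'I_n.+1 -> R =>
      flow X (v ord0) (\row_(i < n) v (lift ord0 i)) 0 j).

Definition integral_curve (R : realType) (n : nat) (X : 'VF[R]_n)
    (x : 'rV[R]_n) : set 'rV[R]_n :=
  [set flow X t x | t in [set: R]].

Definition joint (R : realType) (n : nat) (V : set 'VF[R]_n)
    (L : set (set 'rV[R]_n)) (p : 'rV[R]_n) : Prop :=
  exists (k : nat) (X : 'I_k -> 'VF[R]_n),
    [/\ forall j, V (X j), lspan (range X) = V &
        forall j, L (integral_curve (X j) p)].

(* Main.v *)
Require Import Defs.
From HB Require Import structures.
From mathcomp Require Import all_boot all_order all_algebra.
From mathcomp Require mpoly.
From mathcomp Require Import zify ring.

(** The proof is the polynomial method for joints, with the brackets of vector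
    fields taking over the role that transversality of lines plays classically.

    Write L_X P for the derivative of a polynomial P along a field X. Every X in
    V is a polynomial field, being the velocity at time 0 of a polynomial flow,
    and P restricted to an integral curve of X is a polynomial of degree at most
    N * deg P in the time. Let J be a finite set of joints, and suppose that
    every curve of L carries more than N * (d + N^2) points of J. If P has degree
    at most d and vanishes on J, it then vanishes along every curve of L, hence
    L_X P vanishes at a joint p for the fields X that form it, and by linearity
    for all X in V ([dmeval_joint]). So L_X P vanishes on J as well, and its
    degree has grown by at most N; there is room to repeat this N times, whence
    L_B P vanishes on J for every nested bracket B of length at most N
    ([vanishes_nested_bracket]). The Hörmander condition turns this into the
    vanishing of all partial derivatives of P on J ([vanishes_mderiv]), and these
    have smaller degree. By descent P = 0 ([vanishes_eq0]).

    On the other hand, counting coefficients gives a nonzero polynomial of degree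
    at most n * e vanishing on J as soon as #J < (e+1)^n. Therefore some curve of
    L carries at most a constant times e points of J ([exists_poor_curve]).
    Removing it together with its points leaves joints formed by the other
    curves, so that #J <= K * #L * e by induction on #L ([card_joints_le]). With
    e the integer part of the n-th root of #J this reads
    #J^(n-1) <= (K * #L)^n. The bound holds for all finite sets of joints, which
    also gives the finiteness of the set of all joints. *)

Set Implicit Arguments.
Unset Strict Implicit.
Unset Printing Implicit Defensive.

(** * Multivariate polynomials and polynomial vector fields *)

(* The notations of multivariate polynomials are incompatible with those of
   analysis, hence a module closed before the latter are imported. *)
Module PolynomialMethod.
Import mpoly Order.TTheory GRing.Theory Num.Theory.
Local Open Scope ring_scope.

(** Identities between ring morphisms or derivations of the polynomial ring need
    only be checked on constants and variables. *)
Lemma mpoly_ring_ind (n : nat) (R : comNzRingType) (Q : {mpoly R[n]} -> Prop) :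
    (forall c, Q c%:MP) -> (forall i, Q 'X_i) ->
    (forall p q, Q p -> Q q -> Q (p + q)) ->
    (forall p q, Q p -> Q q -> Q (p * q)) ->
  forall p, Q p.
Proof.
move=> QC QX QD QM p; rewrite [p]mpolyE.
apply: (big_ind Q) => //; first exact: QC 0.
move=> m _; rewrite -mul_mpolyC; apply: (QM) => //.
rewrite mpolyXE_id; apply: (big_ind Q); [exact: QC 1|exact: QM|].
by move=> i _; elim: (m i) => [|k IH]; [exact: QC 1 | rewrite exprS; exact: QM].
Qed.

(** Substituting elements of degree at most K multiplies degrees by at most K.
    The notion of degree on the target is an arbitrary filtration F, so that the
    bound serves both for univariate and for multivariate targets. *)
Lemma mmap_filtration (n : nat) (R S : comNzRingType) (F : nat -> S -> Prop)
    (f : {rmorphism R -> S}) (h : 'I_n -> S) (K : nat) (p : {mpoly R[n]}) :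
    (forall k l a, (k <= l)%N -> F k a -> F l a) ->
    (forall k a b, F k a -> F k b -> F k (a + b)) ->
    (forall k l a b, F k a -> F l b -> F (k + l)%N (a * b)) ->
    (forall c, F 0 (f c)) -> (forall i, F K (h i)) ->
  F (K * (msize p).-1)%N (mmap f h p).
Proof.
move=> Fle FD FM Ff Fh.
have F0 k : F k 0 by apply: (Fle 0) => //; rewrite -(rmorph0 f).
rewrite /mmap big_seq; apply: big_ind => //; first exact: FD.
move=> m /msize_mdeg_lt mp.
apply: (Fle (0 + K * mdeg m)%N); first by rewrite add0n leq_mul2l; lia.
apply: (FM) => //; rewrite mdegE big_distrr /= /mmap1.
apply: (big_ind2 (fun a k => F k a)); first by rewrite -(rmorph1 f).
  by move=> a k b l; exact: (FM).
move=> i _; elim: (m i) => [|k IH]; first by rewrite muln0 expr0 -(rmorph1 f).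
by rewrite exprS mulnS; apply: (FM).
Qed.

Lemma msize_leP (n : nat) (R : comNzRingType) (p : {mpoly R[n]}) (k : nat) :
  reflect (forall m, m \in msupp p -> (mdeg m < k)%N) (msize p <= k)%N.
Proof.
apply: (iffP idP) => [pk m /msize_mdeg_lt mp|mk]; first exact: leq_trans pk.
by rewrite msizeE; apply/bigmax_leqP_seq => m /mk.
Qed.

Lemma mderivXU (n : nat) (R : nzRingType) (i j : 'I_n) :
  ('X_i : {mpoly R[n]})^`M(j) = (i == j)%:R%:MP.
Proof.
rewrite mderivX mnm1E; case: eqVneq => [->|_]; last by rewrite scale0r mpolyC0.
rewrite scale1r mpolyC1 -mpolyX0; congr 'X_[_].
by apply/mnmP => k; rewrite mnmBE subnn mnm0E.
Qed.

Section Degree.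
Context (n : nat) (R : idomainType).
Implicit Types (p q : {mpoly R[n]}) (b c : 'I_n -> {mpoly R[n]}).

Lemma msizeD_leq p q k :
  (msize p <= k)%N -> (msize q <= k)%N -> (msize (p + q) <= k)%N.
Proof.
by move=> pk qk; apply: leq_trans (msizeD_le _ _) _; rewrite geq_max pk.
Qed.

Lemma msizeM_leq p q k l :
  (msize p <= k.+1)%N -> (msize q <= l)%N -> (msize (p * q) <= k + l)%N.
Proof.
have [->|p0] := eqVneq p 0; first by rewrite mul0r msize0.
have [->|q0] := eqVneq q 0; first by rewrite mulr0 msize0.
by rewrite msizeM //; lia.
Qed.

Lemma msize_mderiv p i k : (msize p <= k.+1)%N -> (msize p^`M(i) <= k)%N.
Proof.
move/msize_leP=> pk; apply/msize_leP => m; rewrite mcoeff_msupp mcoeff_mderiv.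
move=> pm; have: (m + U_(i))%MM \in msupp p.
  by rewrite mcoeff_msupp; apply: contraNneq pm => ->; rewrite mul0rn.
by move/pk; rewrite mdegD mdeg1 addn1 ltnS.
Qed.

(** The derivative of p along the vector field with components b. *)
Definition lieD b p := \sum_i b i * p^`M(i).

Definition bracket b c : 'I_n -> {mpoly R[n]} :=
  fun j => lieD b (c j) - lieD c (b j).

Lemma msize_lieD b p k l :
    (forall i, msize (b i) <= k.+1)%N -> (msize p <= l.+1)%N ->
  (msize (lieD b p) <= k + l)%N.
Proof.
move=> bk pl; rewrite /lieD.
apply: (big_ind (fun q => msize q <= k + l)%N) => [|q r|i _].
- by rewrite msize0.
- exact: msizeD_leq.
- exact/msizeM_leq/msize_mderiv.
Qed.

Lemma msize_bracket b c k l :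
    (forall i, msize (b i) <= k.+1)%N -> (forall i, msize (c i) <= l.+1)%N ->
  forall i, (msize (bracket b c i) <= (k + l).+1)%N.
Proof.
move=> bk cl i; apply: msizeD_leq; rewrite ?msizeN; apply: leqW.
  exact: msize_lieD.
by rewrite addnC; exact: msize_lieD.
Qed.

(** In L_b (L_c p) the second derivatives of p enter through a form that is
    symmetric in b and c, so that they cancel in the commutator. *)
Lemma lieD_bracket b c p :
  lieD (bracket b c) p = lieD b (lieD c p) - lieD c (lieD b p).
Proof.
(* the second-order part of L_b (L_c p) *)
pose S2 b c := \sum_i \sum_j b i * (c j * p^`M(j)^`M(i)).
have lieDD b' c' : lieD b' (lieD c' p)
    = \sum_j lieD b' (c' j) * p^`M(j) + S2 b' c'.
  rewrite /S2 exchange_big -big_split /=.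
  transitivity (\sum_i \sum_j b' i * (c' j * p^`M(j))^`M(i)).
    by apply: eq_bigr => i _; rewrite [lieD c' p]/lieD raddf_sum big_distrr.
  rewrite exchange_big; apply: eq_bigr => j _.
  rewrite {1}/lieD mulr_suml -big_split /=.
  by apply: eq_bigr => i _; rewrite mderivM mulrDr; congr (_ + _); rewrite mulrA.
have S2C : S2 b c = S2 c b.
  rewrite /S2 exchange_big; apply: eq_bigr => i _; apply: eq_bigr => j _.
  by rewrite mderiv_comm mulrCA.
rewrite !lieDD S2C opprD addrACA subrr addr0 -sumrB.
by apply: eq_bigr => j _; rewrite -mulrBl.
Qed.

End Degree.

(** This is where characteristic 0 enters: a p-th power has zero derivatives in
    characteristic p. *)
Lemma mderiv_eq0_const (n : nat) (R : numDomainType) (p : {mpoly R[n]}) :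
  (forall i, p^`M(i) = 0) -> p = (p@_0)%:MP.
Proof.
move=> p'0; apply: msize1_polyC; apply/msize_leP => m pm.
rewrite ltnS leqn0 mdeg_eq0; apply: contraLR pm => m0.
have [i mi] : exists i, m i != 0%N.
  apply/existsP; apply: contraR m0; rewrite negb_exists => /forallP mi0.
  by apply/eqP/mnmP => i; rewrite mnm0E; apply/eqP; move: (mi0 i); rewrite negbK.
have Em : (m - U_(i) + U_(i))%MM = m.
  apply/mnmP => j; rewrite mnmDE mnmBE subnK // mnm1E.
  by case: eqP => // <-; rewrite lt0n.
have := congr1 (mcoeff (m - U_(i))%MM) (p'0 i).
rewrite mcoeff_mderiv Em mcoeff0 => /eqP.
by rewrite mulrn_eq0 /= mcoeff_eq0.
Qed.

Section Curves.
Context (n : nat) (R : idomainType).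
Implicit Types (p : {mpoly R[n]}) (h : 'I_n -> {poly R}).

(** The restriction of p to the parametrized polynomial curve h. *)
Definition along h p : {poly R} := mmap polyC h p.

Lemma horner_along h p t : (along h p).[t] = p.@[fun i => (h i).[t]].
Proof.
elim/mpoly_ring_ind: p => [c|i|p q IHp IHq|p q IHp IHq].
- by rewrite /along mmapC mevalC hornerC.
- by rewrite /along mmapX mmap1U mevalXU.
- by rewrite /along raddfD /= hornerD mevalD IHp IHq.
- by rewrite /along rmorphM /= hornerM mevalM IHp IHq.
Qed.

Lemma size_along h p k : (forall i, size (h i) <= k.+1)%N ->
  (size (along h p) <= (k * (msize p).-1).+1)%N.
Proof.
move=> hk; pose F k (a : {poly R}) : Prop := (size a <= k.+1)%N.
apply: (@mmap_filtration _ _ _ F) => //; rewrite /F.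
- by move=> k' l a kl ak; apply: leq_trans ak _.
- by move=> k' a b ak bk; rewrite (leq_trans (size_polyD _ _))// geq_max ak.
- move=> k' l a b ak bl; apply: leq_trans (size_polyMleq _ _) _; lia.
- by move=> c; rewrite size_polyC_leq1.
Qed.

Lemma deriv_along h p :
  (along h p)^`() = \sum_i along h p^`M(i) * (h i)^`().
Proof.
rewrite /along; elim/mpoly_ring_ind: p => [c|j|p q IHp IHq|p q IHp IHq].
- rewrite mmapC derivC big1 // => i _.
  by rewrite mderivC raddf0 mul0r.
- rewrite mmapX mmap1U (bigD1 j) //= big1 => [|i ij]; rewrite mderivXU mmapC.
    by rewrite eqxx mulr1n /= mul1r addr0.
  by rewrite eq_sym (negbTE ij) /= mul0r.
- rewrite raddfD /= derivD IHp IHq -big_split /=.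
  by apply: eq_bigr => i _; rewrite raddfD /= raddfD mulrDl.
- rewrite rmorphM /= derivM IHp IHq mulr_suml mulr_sumr -big_split /=.
  apply: eq_bigr => i _; rewrite mderivM raddfD /= !rmorphM /= mulrDl.
  by rewrite mulrAC -!mulrA.
Qed.

End Curves.

(** P is one component of a flow, as a polynomial in the time (variable 0) and
    the starting point x; q is its trajectory from x, and b the velocity field at
    time 0. That b has degree at most N rests on P having degree at most N
    jointly in time and space. *)
Lemma velocity_mpoly (n N : nat) (R : idomainType) (P : {mpoly R[n.+1]}) :
    (msize P <= N.+1)%N ->
  exists b : {mpoly R[n]}, (msize b <= N.+1)%N /\
    forall x : 'I_n -> R, exists q : {poly R},
      [/\ (size q <= N.+1)%N, q^`().[0] = b.@[x] &
          forall t, q.[t] =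
            P.@[fun i => if unlift ord0 i is Some j then x j else t]].
Proof.
move=> PN.
(* the substitution of 0 for the time *)
pose s i : {mpoly R[n]} := if unlift ord0 i is Some j then 'X_j else 0.
exists (mmap (@mpolyC n R) s P^`M(ord0)); split.
  have /leq_trans : (msize P^`M(ord0) <= N)%N by exact: msize_mderiv.
  pose F k (a : {mpoly R[n]}) : Prop := (msize a <= k.+1)%N.
  have : F (1 * (msize P^`M(ord0)).-1)%N (mmap (@mpolyC n R) s P^`M(ord0)).
    apply: (@mmap_filtration _ _ _ F) => //; rewrite /F.
    - by move=> k' l a kl ak; apply: leq_trans ak _.
    - by move=> k' a b; apply: msizeD_leq.
    - by move=> k l a b ak bl; rewrite -addnS; exact: msizeM_leq.
    - by move=> c; rewrite msizeC; case: eqP.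
    - by rewrite /s => i; case: unliftP => *; rewrite ?msize0 // msizeX mdeg1.
  rewrite /F => /leq_trans + _; apply; rewrite mul1n ltnS.
  by have := @msize_mderiv _ _ P ord0 N PN; lia.
move=> x; pose h i := if unlift ord0 i is Some j then (x j)%:P else 'X.
exists (along h P); split.
- apply: leq_trans (size_along (k := 1) _ _) _; last by rewrite mul1n; lia.
  rewrite /h => i; case: unliftP => *; first by rewrite leqW ?size_polyC_leq1.
  by rewrite size_polyX.
- rewrite deriv_along big_ord_recl big1 => [|i _]; last first.
    by rewrite /h liftK derivC mulr0.
  rewrite /h unlift_none derivX mulr1 addr0 horner_along.
  elim/mpoly_ring_ind: (P^`M(ord0)) => [c|i|p q IHp IHq|p q IHp IHq].
  + by rewrite mmapC !mevalC.
  + rewrite mmapX mmap1U mevalXU /s; case: unliftP => [j|] _.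
      by rewrite hornerC mevalXU.
    by rewrite hornerX meval0.
  + by rewrite !raddfD /= IHp IHq.
  + by rewrite !rmorphM /= IHp IHq.
- move=> t; rewrite horner_along; apply: meval_eq => i; rewrite /h.
  by case: unliftP => *; rewrite ?hornerX ?hornerC.
Qed.

(** The polynomials of degree at most e in each variable form a space of
    dimension (e+1)^n, so that fewer vanishing conditions than this have a
    nontrivial common solution. *)
Lemma exists_vanishing_mpoly (n e : nat) (R : fieldType)
    (s : seq ('I_n -> R)) :
    (size s < e.+1 ^ n)%N ->
  exists P : {mpoly R[n]}, [/\ P != 0, (msize P <= (n * e).+1)%N &
    forall k, (k < size s)%N -> P.@[nth (fun=> 0) s k] = 0].
Proof.
move=> se; pose T : finType := {ffun 'I_n -> 'I_e.+1}.
have cT : #|T| = (e.+1 ^ n)%N by rewrite card_ffun !card_ord.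
(* T indexes the exponents of the monomials of degree at most e in each
   variable *)
pose mon (a : 'I_#|T|) : 'X_{1..n} := [multinom (enum_val a i : nat) | i < n].
have mon_inj : injective mon.
  move=> a b /mnmP ab; apply: enum_val_inj; apply/ffunP => i.
  by apply: val_inj; have := ab i; rewrite !mnmE.
pose A : 'M[R]_(#|T|, size s) :=
  \matrix_(a, k) ('X_[mon a] : {mpoly R[n]}).@[nth (fun=> 0) s k].
(* A has more rows than columns *)
have [v vA v0] : exists2 v : 'rV_#|T|, v *m A = 0 & v != 0.
  have /rowV0Pn [v /sub_kermxP vA v0] : kermx A != 0.
    rewrite kermx_eq0 -row_leq_rank -ltnNge.
    by apply: leq_ltn_trans (rank_leq_col A) _; rewrite cT.
  by exists v.
pose P : {mpoly R[n]} := \sum_a v 0 a *: 'X_[mon a].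
have Pmon a : P@_(mon a) = v 0 a.
  rewrite /P raddf_sum /= (bigD1 a) //= big1 => [|b ba].
    by rewrite mcoeffZ mcoeffX eqxx mulr1 addr0.
  by rewrite mcoeffZ mcoeffX (inj_eq mon_inj) (negbTE ba) mulr0.
exists P; split.
- apply: contraNneq v0 => P0; apply/eqP/rowP => a.
  by rewrite -Pmon P0 mcoeff0 mxE.
- rewrite /P; apply: (big_ind (fun q => msize q <= (n * e).+1)%N) => [|p q|a _].
  + by rewrite msize0.
  + exact: msizeD_leq.
  apply: leq_trans (msizeZ_le _ _) _; rewrite msizeX ltnS mdegE.
  rewrite -[X in (X * _)%N]card_ord -sum_nat_const leq_sum // => i _.
  by rewrite mnmE -ltnS.
- move=> k ks; have := congr1 (fun M : 'rV_(size s) => M 0 (Ordinal ks)) vA.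
  rewrite !mxE; apply: etrans; rewrite /P raddf_sum /=.
  by apply: eq_bigr => a _; rewrite mevalZ !mxE.
Qed.

End PolynomialMethod.

From mathcomp Require Import finmap.
From mathcomp Require Import all_classical all_reals all_analysis.
Import Order.TTheory GRing.Theory Num.Theory.
Import numFieldNormedType.Exports.
Import PolynomialMethod.

Local Open Scope classical_set_scope.
Local Open Scope ring_scope.

Local Notation "''MP[' R ]_ n" := (mpoly.mpoly n R)
  (at level 8, n at level 2) : type_scope.

(** * Polynomial vector fields and polynomial flows *)

Section PolynomialFields.
Import -(notations) mpoly.
Context (R : realType) (n : nat).
Implicit Types (P : 'MP[R]_n) (x v : 'rV[R]_n) (X Y : 'VF[R]_n).

(** The differential of P at x applied to v, in the algebraic form that is linear
    in v by construction; [is_diff_meval] identifies it with the analytic one. *)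
Definition dmeval P x v : R :=
  \sum_i v 0 i * meval (x 0) (mderiv i P).

Lemma dmeval_lincomb P x k (c : 'I_k -> R) (u : 'I_k -> 'rV[R]_n) :
  dmeval P x (\sum_i c i *: u i) = \sum_i c i * dmeval P x (u i).
Proof.
rewrite /dmeval; under [RHS]eq_bigr do rewrite mulr_sumr.
rewrite exchange_big; apply: eq_bigr => j _; rewrite summxE mulr_suml.
by apply: eq_bigr => i _; rewrite mxE mulrA.
Qed.

Lemma is_diff_meval P x :
  is_diff x (fun y : 'rV[R]_n => meval (y 0) P) (dmeval P x).
Proof.
elim/mpoly_ring_ind: P => [c|i|p q IHp IHq|p q IHp IHq].
- rewrite (_ : (fun _ => _) = cst c); last first.
    by apply/funext => y; rewrite mevalC.
  apply: is_diff_eq; apply/funext => v; rewrite /dmeval big1 //= => i _.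
  by rewrite mderivC meval0 mulr0.
- rewrite (_ : (fun _ => _) = (fun y : 'rV[R]_n => y 0 i)); last first.
    by apply/funext => y; rewrite mevalXU.
  have @coord : {linear 'rV[R]_n -> R}.
    by exists (fun y : 'rV[R]_n => y 0 i); do 2![eexists]; do ?[constructor];
      rewrite ?mxE// => ? *; rewrite ?mxE//; move=> ?; rewrite !mxE.
  rewrite (_ : (fun _ => _) = coord) //.
  have cont : continuous coord by exact: coord_continuous.
  apply: DiffDef; first exact: linear_differentiable.
  rewrite diff_lin //; apply/funext => v /=.
  rewrite /dmeval (bigD1 i) //= big1 => [|j ji]; rewrite mderivXU mevalC.
    by rewrite eqxx mulr1 addr0.
  by rewrite eq_sym (negbTE ji) mulr0.
- rewrite (_ : (fun _ => _) = (fun y : 'rV[R]_n => meval (y 0) p) +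
      (fun y : 'rV[R]_n => meval (y 0) q)); last first.
    by apply/funext => y; rewrite mevalD.
  apply: is_diff_eq; apply/funext => v; rewrite /dmeval /= fctE -big_split /=.
  by apply: eq_bigr => i _; rewrite mderivD mevalD mulrDr.
- rewrite (_ : (fun _ => _) = (fun y : 'rV[R]_n => meval (y 0) p) *
      (fun y : 'rV[R]_n => meval (y 0) q)); last first.
    by apply/funext => y; rewrite mevalM.
  apply: is_diff_eq; apply/funext => v; rewrite /dmeval /= !fctE.
  rewrite !scaler_sumr -big_split /=.
  apply: eq_bigr => i _; rewrite mderivM mevalD !mevalM mulrDr.
  rewrite /GRing.scale /=; ring.
Qed.

Definition mpoly_field (k : nat) (X : 'VF[R]_n) (b : 'I_n -> 'MP[R]_n) : Prop :=
  (forall j, mpoly.msize (b j) <= k.+1)%N /\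
  forall x j, X x 0 j = meval (x 0) (b j).

Lemma meval_lieD k X b P x : mpoly_field k X b ->
  meval (x 0) (lieD b P) = dmeval P x (X x).
Proof.
move=> [_ Xb]; rewrite /lieD raddf_sum /=; apply: eq_bigr => i _.
by rewrite mevalM Xb.
Qed.

Lemma diff_mpoly_field k X b x v : mpoly_field k X b ->
  forall j, ('d X x v : 'rV[R]_n) 0 j = dmeval (b j) x v.
Proof.
move=> [_ Xb] j0.
pose f j : 'VF[R]_n := fun y => meval (y 0) (b j) *: delta_mx 0 j.
pose df j : 'VF[R]_n := fun w => dmeval (b j) x w *: delta_mx 0 j.
have fj j : is_diff x (f j) (df j).
  have [dbj eqbj] := is_diff_meval (b j) x.
  apply: DiffDef; first exact: differentiableZl.
  by rewrite diffZl //; apply/funext => w; rewrite eqbj.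
have -> : X = \sum_j f j.
  apply/funext => y; apply/rowP => j; rewrite Xb fct_sumE summxE (bigD1 j) //=.
  rewrite big1 => [|i ij]; rewrite !mxE ?eqxx /= ?mulr1 ?addr0 //.
  by rewrite eq_sym (negbTE ij) mulr0.
have : is_diff x (\sum_j f j) (\sum_j df j).
  elim/big_ind2: _ => [|? ? ? ? d1 d2|j _]; [exact: is_diff_cst | | exact: fj].
  exact: is_diffD.
move=> [_ ->]; rewrite fct_sumE summxE (bigD1 j0) //=.
rewrite big1 => [|i ij]; rewrite !mxE ?eqxx /= ?mulr1 ?addr0 //.
by rewrite eq_sym (negbTE ij) mulr0.
Qed.

Lemma mpoly_field_bracket k l X Y b c :
    mpoly_field k X b -> mpoly_field l Y c ->
  mpoly_field (k + l) (lie_bracket X Y) (bracket b c).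
Proof.
move=> Xb Yc; split=> [j|x j].
  by apply: msize_bracket => i; [case: Xb|case: Yc].
rewrite /bracket mevalB (meval_lieD _ _ Xb) (meval_lieD _ _ Yc).
have -> : lie_bracket X Y x = 'd Y x (X x) - 'd X x (Y x) by [].
rewrite [LHS]mxE [X in _ + X]mxE.
congr (_ - _); first exact: (diff_mpoly_field _ _ Yc).
exact: (diff_mpoly_field _ _ Xb).
Qed.

(** The components of X are obtained by differentiating the flow at time 0. *)
Lemma flow_poly N X : polynomial_flow N X ->
  exists b, mpoly_field N X b /\
    forall x, exists q : 'I_n -> {poly R},
      [/\ forall j, (size (q j) <= N.+1)%N,
          forall t j, flow X t x 0 j = (q j).[t] &
          forall j, (q j)^`().[0] = X x 0 j].
Proof.
move=> [flowX polyX].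
have /fin_all_exists[b bP] : forall j, exists b : 'MP[R]_n,
    (mpoly.msize b <= N.+1)%N /\
    forall x : 'rV[R]_n, exists q : {poly R},
      [/\ (size q <= N.+1)%N, q^`().[0] = meval (x 0) b &
          forall t, flow X t x 0 j = q.[t]].
  move=> j; have [P [PN flowP]] := polyX j.
  have [b [bN bP]] := velocity_mpoly PN; exists b; split=> // x.
  have [q [qN q'0 qP]] := bP (x 0); exists q; split=> // t.
  rewrite qP -flowP unlift_none; congr (flow X t _ 0 j).
  by apply/rowP => i; rewrite mxE liftK.
have Xq x j (q : {poly R}) : (forall t, flow X t x 0 j = q.[t]) ->
    X x 0 j = q^`().[0].
  move=> qP; have [flow0 dflow] := flowX x.
  have [dfl fl'] := dflow 0; rewrite -[in LHS]flow0 -fl' derive_mx //.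
  rewrite mxE (_ : (fun _ => _) = horner q); last exact/funext.
  exact: derive_val.
exists b; split.
  split=> [j|x j]; first by case: (bP j).
  have [_ /(_ x)[q [_ <- qP]]] := bP j; exact: Xq.
move=> x; have /fin_all_exists[q qP] : forall j, exists q : {poly R},
    (size q <= N.+1)%N /\ forall t, flow X t x 0 j = q.[t].
  by move=> j; have [_ /(_ x)[q [? _ ?]]] := bP j; exists q.
exists q; split=> [j|t j|j]; first by case: (qP j).
  by case: (qP j).
by rewrite (Xq x j (q j)) //; case: (qP j).
Qed.

End PolynomialFields.

(** * Polynomials vanishing on joints of rich curves *)

Section Vanishing.
Import -(notations) mpoly.
Context (R : realType) (n N : nat) (V : set 'VF[R]_n).
Context (L : set (set 'rV[R]_n)) (J : {fset 'rV[R]_n}) (M : nat).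
Hypothesis (flowV : forall X, V X -> polynomial_flow N X).
Hypothesis (hormanderV : hormander N V).
Hypothesis (jointJ : forall p, p \in J -> joint V L p).
Hypothesis (richL : forall l, L l ->
  (N * M < #|` [fset p in J | `[<l p>]]%fset|)%N).

Definition vanishes (P : 'MP[R]_n) : Prop :=
  forall p : 'rV[R]_n, p \in J -> meval (p 0) P = 0.

(** The restriction of P to the curve has more zeros than its degree, so it is
    identically zero, and so is its derivative at time 0. *)
Lemma dmeval_curve P X p : vanishes P -> (mpoly.msize P <= M.+1)%N ->
  V X -> L (integral_curve X p) -> dmeval P p (X p) = 0.
Proof.
move=> PJ PM VX /richL many.
have [b [Xb flow_q]] := flow_poly (flowV VX).
have [q [qN qE q'0]] := flow_q p.
have flow0 : flow X 0 p = p by have [/(_ p)[]] := flowV VX.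
have flowE t : (fun i => (q i).[t]) = flow X t p 0.
  by apply/funext => i; rewrite qE.
have P0 : along q P = 0.
  pose s := [fset x in J | `[<integral_curve X p x>]]%fset.
  have /choice[tm tmP] : forall x : 'rV[R]_n, exists t, x \in s -> flow X t p = x.
    move=> x; have [|xs] := boolP (x \in s); last by exists 0.
    by rewrite !inE /= => /andP[_ /asboolP[t _ tx]]; exists t.
  apply: (@roots_geq_poly_eq0 _ _ [seq tm x | x <- s]).
  - apply/allP => _ /mapP[x xs ->]; apply/eqP.
    rewrite horner_along flowE tmP //; apply: PJ.
    by move: xs; rewrite !inE => /andP[].
  - rewrite map_inj_in_uniq ?fset_uniq // => x y xs ys.
    by move=> /(congr1 (fun t => flow X t p)); rewrite !tmP.
  - rewrite size_map; apply: leq_trans (size_along P qN) _.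
    apply: leq_trans many; rewrite ltnS leq_mul2l -subn1 leq_subLR add1n.
    by rewrite PM orbT.
have := deriv_along q P; rewrite P0 deriv0 => /(congr1 (horner^~ 0)).
rewrite horner0 horner_sum => D0; rewrite [RHS]D0; apply: eq_bigr => i _.
by rewrite hornerM q'0 horner_along flowE flow0 mulrC.
Qed.

(** The fields forming the joint p span V, and the differential of P at p is
    linear. *)
Lemma dmeval_joint P X p : vanishes P -> (mpoly.msize P <= M.+1)%N ->
  V X -> p \in J -> dmeval P p (X p) = 0.
Proof.
move=> PJ PM VX /jointJ[k [Y [VY spanY LY]]].
have : lspan (range Y) X by rewrite spanY.
move=> [m [c [u [uY ->]]]]; rewrite fct_sumE.
rewrite (_ : \sum_i _ = \sum_i c i *: u i p); last by apply: eq_bigr.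
rewrite dmeval_lincomb big1 // => i _.
by have [j _ <-] := uY i; rewrite dmeval_curve ?mulr0.
Qed.

(** For B = [X, Y] this follows from L_B P = L_X (L_Y P) - L_Y (L_X P). Each of
    the m differentiations that precede the last one raises the degree by at most
    N, and the degree must stay within the bound M up to which the curves are
    rich: this is the condition on d + m * N. *)
Lemma vanishes_nested_bracket m B : nested_brackets V m B ->
  exists b, mpoly_field (m.+1 * N) B b /\
    forall P d, vanishes P -> (mpoly.msize P <= d.+1)%N -> (d + m * N <= M)%N ->
      vanishes (lieD b P).
Proof.
elim: m B => [|m IH] B /=.
  move=> VB; have [b [Bb _]] := flow_poly (flowV VB); exists b; split.
    by rewrite mul1n.
  move=> P d PJ Pd dM p pJ; rewrite (meval_lieD _ _ Bb) dmeval_joint //.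
  by apply: leq_trans Pd _; rewrite ltnS; lia.
move=> [X VX [Y VY <-]].
have [b [Xb _]] := flow_poly (flowV VX).
have [c [Yc cJ]] := IH Y VY.
exists (bracket b c); split; first exact: mpoly_field_bracket.
move=> P d PJ Pd dM p pJ; rewrite lieD_bracket mevalB.
have bP : (mpoly.msize (lieD b P) <= (N + d).+1)%N.
  by apply: leqW; apply: msize_lieD => //; case: Xb.
have cP : (mpoly.msize (lieD c P) <= (m.+1 * N + d).+1)%N.
  by apply: leqW; apply: msize_lieD => //; case: Yc.
have lieX Q : vanishes Q -> (mpoly.msize Q <= M.+1)%N -> vanishes (lieD b Q).
  by move=> QJ QM x xJ; rewrite (meval_lieD _ _ Xb) dmeval_joint.
rewrite (lieX _ _ _ p pJ); first 1 last.
- by apply: (cJ P d) => //; nia.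
- by apply: leq_trans cP _; rewrite ltnS; nia.
rewrite (cJ (lieD b P) (N + d)%N) ?subrr //; last by nia.
by apply: lieX => //; apply: leq_trans Pd _; rewrite ltnS; nia.
Qed.

(** By the Hörmander condition a partial derivative at p is a combination of
    derivatives along brackets of length at most N. *)
Lemma vanishes_mderiv P d i : vanishes P -> (mpoly.msize P <= d.+1)%N ->
  (d + N * N <= M)%N -> vanishes (mderiv i P).
Proof.
move=> PJ Pd dM p pJ.
have : [set: 'rV[R]_n] (delta_mx 0 i) by [].
rewrite -(hormanderV p) => -[k [c [u [uB eE]]]].
transitivity (dmeval P p (delta_mx 0 i)).
  rewrite /dmeval (bigD1 i) //= big1 => [|j ji]; rewrite !mxE ?eqxx /=.
    by rewrite mul1r addr0.
  by rewrite (negbTE ji) mul0r.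
rewrite eE dmeval_lincomb big1 // => j _.
have [B [m mN mB] <-] := uB j.
have [b [Bb bJ]] := vanishes_nested_bracket mB.
rewrite -(meval_lieD _ _ Bb) (bJ P d) ?mulr0 //.
by apply: leq_trans dM; rewrite leq_add2l leq_mul2r ltnW ?orbT.
Qed.

(** Descent on the degree: all partial derivatives of P vanish on J and are thus
    zero, so that P is constant, and it has a zero. *)
Lemma vanishes_eq0 P d : J != fset0%fset ->
  vanishes P -> (mpoly.msize P <= d.+1)%N -> (d + N * N <= M)%N -> P = 0.
Proof.
case/fset0Pn => p pJ; elim: d P => [|d IH] P PJ Pd dM.
  have Pc := msize1_polyC Pd.
  by have := PJ p pJ; rewrite Pc mevalC => ->; rewrite mpolyC0.
have /mderiv_eq0_const Pc : forall i, mderiv i P = 0.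
  move=> i; apply: IH.
  - exact: vanishes_mderiv PJ Pd dM.
  - exact: msize_mderiv.
  - by apply: leq_trans dM; rewrite leq_add2r.
by have := PJ p pJ; rewrite Pc mevalC => ->; rewrite mpolyC0.
Qed.

End Vanishing.

(** * Counting joints *)

(** Otherwise the polynomial of degree at most n * e that vanishes on J would
    have to be zero. *)
Lemma exists_poor_curve (R : realType) (n N e : nat) (V : set 'VF[R]_n)
    (L : set (set 'rV[R]_n)) (J : {fset 'rV[R]_n}) :
    (forall X, V X -> polynomial_flow N X) -> hormander N V ->
    (forall p, p \in J -> joint V L p) -> J != fset0%fset ->
    (#|` J| < e.+1 ^ n)%N ->
  exists2 l, L l &
    (#|` [fset p in J | `[<l p>]]%fset| <= N * (n * e + N * N))%N.
Proof.
move=> flowV hormV jointJ J0 Je; apply: contrapT => poor.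
have rich l : L l ->
    (N * (n * e + N * N) < #|` [fset p in J | `[<l p>]]%fset|)%N.
  by move=> Ll; rewrite ltnNge; apply/negP => ll; apply: poor; exists l.
pose s := [seq (x : 'rV[R]_n) 0 | x <- J].
have [|P [P0 Pne Ps]] := @exists_vanishing_mpoly n e R s.
  by rewrite size_map.
move/eqP: P0; apply; apply: (vanishes_eq0 flowV hormV jointJ rich J0 _ Pne) => //.
move=> p pJ; have pi : (index p J < size J)%N by rewrite index_mem.
rewrite -(Ps (index p J)) ?size_map // (nth_map p) //.
by rewrite nth_index.
Qed.

(** A joint that is not on the curve l is still a joint of the remaining curves,
    because none of the curves through it is l. The parameter e is kept fixed
    throughout the induction, although J shrinks. *)
Lemma card_joints_le (R : realType) (n N e : nat) (V : set 'VF[R]_n)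
    (L : {fset set 'rV[R]_n}) (J : {fset 'rV[R]_n}) :
    (forall X, V X -> polynomial_flow N X) -> hormander N V ->
    (forall p, p \in J -> joint V [set` L] p) ->
    (0 < e)%N -> (#|` J| < e.+1 ^ n)%N ->
  (#|` J| <= #|` L| * (N * (n + N * N) * e))%N.
Proof.
move=> flowV hormV jointJ e0 Je.
have [k Lk] := ubnP #|` L|; elim: k L J Lk jointJ Je => // k IH L J Lk jointJ Je.
have [->|J0] := eqVneq J fset0; first by rewrite cardfs0.
have [l /= lL poor] := exists_poor_curve flowV hormV jointJ J0 Je.
pose J1 := [fset p in J | `[<l p>]]%fset; pose J2 := (J `\` J1)%fset.
have JE : #|` J| = (#|` J1| + #|` J2|)%N.
  rewrite -(cardfsID J1 J); congr (#|` _| + _)%N.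
  by apply/fsetP => p; rewrite !inE; case: (p \in J).
have LE : #|` L| = (#|` (L `\ l)%fset|).+1 by rewrite (cardfsD1 l L) lL.
have J2le : (#|` J2| <= #|` (L `\ l)%fset| * (N * (n + N * N) * e))%N.
  apply: IH.
  - by move: Lk; rewrite LE.
  - move=> p; rewrite !inE negb_and => /andP[+ pJ]; rewrite pJ /= => /asboolP lp.
    have [m [X [VX spanX LX]]] := jointJ p pJ.
    exists m, X; split=> // j /=; rewrite !inE; have := LX j; rewrite /= => ->.
    rewrite andbT; apply/eqP => lE; apply: lp; rewrite -lE.
    by exists 0 => //; have [/(_ p)[]] := flowV _ (VX j).
  - by apply: leq_ltn_trans Je; rewrite JE leq_addl.
rewrite JE LE mulSn leq_add //; apply: leq_trans poor _.
rewrite -mulnA leq_mul2l mulnDl leq_add2l leq_pmulr ?orbT //.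
Qed.

Lemma exists_nat_root (n m : nat) : (0 < n)%N ->
  (0 < m)%N -> exists e, [/\ (0 < e)%N, (e ^ n <= m)%N & (m < e.+1 ^ n)%N].
Proof.
move=> n0 m0.
have ex : exists e, (e ^ n <= m)%N by exists 0%N; rewrite exp0n.
have bd e : (e ^ n <= m)%N -> (e <= m)%N.
  move=> em; apply: leq_trans em; case: e => // e.
  by rewrite -[X in (X <= _)%N]expn1 leq_pexp2l.
case: (ex_maxnP ex bd) => e em emax; exists e; split=> //.
  by apply: emax; rewrite exp1n.
by rewrite ltnNge; apply/negP => /emax; rewrite ltnn.
Qed.

(** Comparing the two bounds for j gives e ^ n <= k, which eliminates e. *)
Lemma exponent_bound (n j k e : nat) : (0 < e)%N ->
  (e ^ n.+1 <= j)%N -> (j <= k * e)%N -> (j ^ n <= k ^ n.+1)%N.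
Proof.
move=> e0 ej jk.
have ek : (e ^ n <= k)%N.
  by rewrite -(leq_pmul2r e0) -expnSr; apply: leq_trans jk.
apply: (@leq_trans ((k * e) ^ n)); first last.
  by rewrite expnMn expnSr leq_mul2l ek orbT.
by case: n {ej ek} => // n; rewrite leq_exp2r.
Qed.

Local Open Scope fset_scope.

Theorem theorem1p2 (R : realType) (n N : nat) (hn : (2 <= n)%N) (hN : (1 <= N)%N) :
  exists C : R,
    forall (V : set 'VF[R]_n) (L : set (set 'rV[R]_n)),
      smooth_subspace V ->
      (forall X, V X -> polynomial_flow N X) ->
      hormander N V ->
      finite_set L ->
      (forall l, L l -> exists X x0, V X /\ l = integral_curve X x0) ->
      finite_set [set p | joint V L p] /\
      #|` fset_set [set p | joint V L p]|%:R
        <= C * (#|` fset_set L|%:R `^ (n%:R / (n%:R - 1))).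
Proof.
case: n hn => [|[|n]] // _.
pose K := (N * (n.+2 + N * N))%N.
exists (K%:R `^ (n.+2%:R / (n.+2%:R - 1))) => V L0 _ flowV hormV.
move=> /finite_fsetP[L ->] _; rewrite set_fsetK.
have card_le (J : {fset 'rV[R]_n.+2}) :
      ([set` J] `<=` [set p | joint V [set` L] p])%classic ->
    (#|` J| ^ n.+1 <= (#|` L| * K) ^ n.+2)%N.
  move=> jointJ; have [->|] := posnP #|` J|; first by rewrite exp0n.
  move=> /(@exists_nat_root n.+2)[//|e [e0 eJ Je]].
  apply: (exponent_bound e0 eJ); rewrite -mulnA.
  exact: (card_joints_le flowV hormV jointJ e0 Je).
(* an infinite set of joints would contain finite ones violating the bound *)
have finJ : finite_set [set p | joint V [set` L] p].
  apply: contrapT => /(@infinite_set_fset _ _ ((#|` L| * K) ^ n.+2).+1).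
  move=> [J /card_le le lt].
  suff : (#|` J| <= (#|` L| * K) ^ n.+2)%N by rewrite leqNgt lt.
  apply: leq_trans le; rewrite -[leqLHS]expn1 leq_pexp2l //.
  exact: leq_trans lt.
split=> //; set J := fset_set _.
have {card_le} : (#|` J| ^ n.+1 <= (#|` L| * K) ^ n.+2)%N.
  by apply: card_le; rewrite fset_setK.
have -> : n.+2%:R - 1 = n.+1%:R :> R by rewrite -natr1 addrK.
rewrite -(ler_nat R) !natrX => JLK; rewrite -powRM //.
have root m (a : R) : 0 <= a -> (a ^+ m) `^ n.+1%:R^-1 = a `^ (m%:R / n.+1%:R).
  by move=> a0; rewrite -powR_mulrn // -powRrM.
have /(_ _)/= := @ge0_ler_powR R n.+1%:R^-1 _ _ _ _ _ JLK.
rewrite !root // natrM divff ?powRr1 // mulrC; apply; rewrite ?nnegrE ?exprn_ge0 //.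
Qed.
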